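(* Let $m$ be a positive integer, let $\alpha>0$, and let $\lambda$ be a nonzero real number. Let $X$ be a Poisson random variable with parameter $\frac{\alpha}{m}$. Then for every integer $n\ge0$, $$E[(mX+1)_{n,\lambda}]=\sum_{k=0}^n\binom{n}{k}(1)_{n-k,\lambda}\,m^k\,\phi_{k,\frac{\lambda}{m}}\Big(\frac{\alpha}{m}\Big)=\sum_{j=0}^n\alpha^j\sum_{k=j}^n\binom{n}{k}(1)_{n-k,\lambda}\,m^{k-j}\,S_{2,\frac{\lambda}{m}}(k,j).$$
   Context: For real $x$ and nonzero real $\mu$, the degenerate falling factorial is $(x)_{0,\mu}=1$, $(x)_{n,\mu}=x(x-\mu)\cdots(x-(n-1)\mu)$ for $n\ge1$; the ordinary falling factorial is $(x)_0=1$, $(x)_k=x(x-1)\cdots(x-k+1)$. The degenerate Stirling numbers of the second kind $S_{2,\mu}(n,k)$ are defined by $(x)_{n,\mu}=\sum_{k=0}^n S_{2,\mu}(n,k)(x)_k$; equivalently $\frac{1}{k!}(e_\mu(t)-1)^k=\sum_{n\ge k}S_{2,\mu}(n,k)\frac{t^n}{n!}$, where $e_\mu(t)=(1+\mu t)^{1/\mu}$. The degenerate Bell polynomials are $\phi_{n,\mu}(x)=\sum_{k=0}^n S_{2,\mu}(n,k)x^k$, i.e. $e^{x(e_\mu(t)-1)}=\sum_{n\ge0}\phi_{n,\mu}(x)\frac{t^n}{n!}$. *)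

(* Defs.v *)
From HB Require Import structures.
From mathcomp Require Import all_boot all_order all_algebra.
From mathcomp Require Import all_classical all_reals all_analysis.

Set Implicit Arguments.
Unset Strict Implicit.
Unset Printing Implicit Defensive.

Import Order.TTheory GRing.Theory Num.Theory.

Local Open Scope classical_set_scope.
Local Open Scope ring_scope.

Definition falling {R : realType} (x : R) (k : nat) : R :=
  \prod_(i < k) (x - i%:R).

Definition degenerate_falling {R : realType} (mu x : R) (n : nat) : R :=
  \prod_(i < n) (x - i%:R * mu).

(* The coefficients expanding (x)_{n,mu} in the falling factorials (x)_k,
   k <= n, extended by 0 for k > n. *)
Definition is_degenerate_stirling2 {R : realType} (mu : R) (n : nat)
    (c : nat -> R) : Prop :=
  (forall x : R,
     degenerate_falling mu x n = \sum_(k < n.+1) c k * falling x k) /\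
  (forall k : nat, (n < k)%N -> c k = 0).

(* [is_degenerate_stirling2 mu n] has exactly one inhabitant (lemmas
   [degenerate_stirling2P] and [degenerate_stirling2_uniq]), so the default
   value of [xget] is never used. *)
Definition degenerate_stirling2 {R : realType} (mu : R) (n : nat) : nat -> R :=
  xget (fun=> 0) [set c | is_degenerate_stirling2 mu n c].

Definition degenerate_bell {R : realType} (mu : R) (n : nat) (x : R) : R :=
  \sum_(k < n.+1) degenerate_stirling2 mu n k * x ^+ k.

(* P(X = k) = e^{-rate} rate^k / k! for all k : nat.  These values sum to 1, so
   the real random variable X is almost surely a natural number.
   [poisson_pmf] has this value only for 0 < rate, whence the first conjunct. *)
Definition is_poisson {d : measure_display} {T : measurableType d}
    {R : realType} (P : probability T R) (X : {RV P >-> R}) (rate : R) : Prop :=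
  0 < rate /\
  forall k : nat, P (X @^-1` [set k%:R]) = (poisson_pmf rate k)%:E.

Lemma degenerate_stirling2_ex {R : realType} (mu : R) (n : nat) :
  exists c : nat -> R, is_degenerate_stirling2 mu n c.
Proof.
elim: n => [|n [c [cE c0]]].
  exists (fun k => (k == 0)%:R); split=> [x|[]//].
  by rewrite /degenerate_falling /falling big_ord1 !big_ord0 mulr1.
exists (fun k => (if k is k'.+1 then c k' else 0) + (k%:R - n%:R * mu) * c k).
split=> [x|[|k] // nk]; last by rewrite !c0 ?mulr0 ?addr0// ltnW.
rewrite /degenerate_falling big_ord_recr /= -/(degenerate_falling mu x n) cE.
under [RHS]eq_bigr do rewrite mulrDl.
rewrite big_split /= [X in _ = X + _]big_ord_recl /= mul0r add0r.
rewrite [X in _ = _ + X]big_ord_recr /= c0// mulr0 mul0r addr0.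
rewrite -big_split /= mulr_suml; apply: eq_bigr => k _.
rewrite /bump add1n.
have -> : falling x k.+1 = falling x k * (x - k%:R).
  by rewrite /falling big_ord_recr.
rewrite -!mulrA [(k%:R - _) * _]mulrCA -mulrDr; congr (_ * _).
by rewrite [X in _ = _ + X]mulrC -mulrDr addrA subrK.
Qed.

Lemma degenerate_stirling2P {R : realType} (mu : R) (n : nat) :
  is_degenerate_stirling2 mu n (degenerate_stirling2 mu n).
Proof.
exact: (@xgetPex _ (fun=> 0) [set c | is_degenerate_stirling2 mu n c]
  (degenerate_stirling2_ex mu n)).
Qed.

Lemma degenerate_stirling2_uniq {R : realType} (mu : R) (n : nat)
    (c : nat -> R) :
  is_degenerate_stirling2 mu n c -> c = degenerate_stirling2 mu n.
Proof.
have [eE e0] := degenerate_stirling2P mu n.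
set e := degenerate_stirling2 mu n in eE e0 *.
move=> [cE c0]; apply/funext => k.
have [nk|kn] := ltnP n k; first by rewrite c0// e0.
elim/ltn_ind: k kn => k IH kn.
have fall0 j : (k < j)%N -> falling (k%:R : R) j = 0.
  move=> kj; rewrite /falling (bigD1 (Ordinal kj))//= subrr mul0r//.
have fallk : falling (k%:R : R) k != 0.
  apply/prodf_neq0 => i _; rewrite subr_eq0 eqr_nat.
  by rewrite gtn_eqF// ltn_ord.
have := cE k%:R; rewrite eE.
have kn1 : (k < n.+1)%N by [].
rewrite (bigD1 (Ordinal kn1))//= [RHS](bigD1 (Ordinal kn1))//=.
rewrite (eq_bigr (fun i : 'I_n.+1 => c i * falling k%:R i)).
  by move=> /addIr /(mulIf fallk).
move=> i ik; have [ki|ik'] := ltnP k i; first by rewrite fall0// !mulr0.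
have ltik : (i < k)%N by rewrite ltn_neqAle ik' andbT.
by rewrite (IH i ltik) // -ltnS.
Qed.

(* Main.v *)
(** By the Vandermonde convolution for [(.)_{n,lambda}] and the scaling
    [(m x)_{k,lambda} = m^k (x)_{k,lambda/m}], the variable [(mX+1)_{n,lambda}]
    is a linear combination of the falling factorials [(X)_j], and the j-th
    factorial moment of a Poisson variable of rate r is [r^j].  Replacing [(X)_j]
    by [r^j] turns degenerate Stirling expansions into degenerate Bell
    polynomials. *)
Require Import Defs.
From HB Require Import structures.
From mathcomp Require Import all_boot all_order all_algebra.
From mathcomp Require Import all_classical all_reals all_analysis.
From mathcomp Require Import measurable_realfun ring.

Set Implicit Arguments.
Unset Strict Implicit.
Unset Printing Implicit Defensive.

Import Order.TTheory GRing.Theory Num.Theory.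

Local Open Scope classical_set_scope.
Local Open Scope ring_scope.

(** * Algebra of degenerate falling factorials *)

Lemma degenerate_fallingS (R : realType) (mu x : R) (n : nat) :
  degenerate_falling mu x n.+1 = degenerate_falling mu x n * (x - n%:R * mu).
Proof. by rewrite /degenerate_falling big_ord_recr. Qed.

Lemma degenerate_fallingD (R : realType) (mu x y : R) (n : nat) :
  degenerate_falling mu (x + y) n =
  \sum_(0 <= k < n.+1) 'C(n, k)%:R * degenerate_falling mu y (n - k) *
    degenerate_falling mu x k.
Proof.
elim: n => [|n IH].
  by rewrite big_nat1 /degenerate_falling !big_ord0 bin0 !mulr1.
rewrite degenerate_fallingS IH mulr_suml.
(* The new factor splits as [x + y - n * mu = (y - (n - k) * mu) + (x - k * mu)], each half
   extending one of the two products. *)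
transitivity (
  \sum_(0 <= k < n.+1) 'C(n, k)%:R * degenerate_falling mu y (n.+1 - k) *
    degenerate_falling mu x k +
  \sum_(0 <= k < n.+1) 'C(n, k)%:R * degenerate_falling mu y (n - k) *
    degenerate_falling mu x k.+1).
  rewrite -big_split /=; apply: eq_big_nat => k /andP[_]; rewrite ltnS => kn.
  rewrite subSn// !degenerate_fallingS natrB//; ring.
rewrite [RHS]big_nat_recl// [X in X + _]big_nat_recl// !bin0 -addrA.
congr (_ + _).
(* The added term [k = n] vanishes since ['C(n, n.+1) = 0]; with equal ranges, Pascal's rule applies
   termwise. *)
rewrite [X in X + _](_ : _ = \sum_(0 <= k < n.+1) 'C(n, k.+1)%:R *
    degenerate_falling mu y (n - k) * degenerate_falling mu x k.+1); last first.
  by rewrite [RHS]big_nat_recr//= bin_small// !mul0r addr0.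
rewrite -big_split /=; apply: eq_bigr => k _.
by rewrite subSS binS natrD !mulrDl.
Qed.

Lemma degenerate_fallingM (R : realType) (mu a x : R) (n : nat) : a != 0 ->
  degenerate_falling mu (a * x) n = a ^+ n * degenerate_falling (mu / a) x n.
Proof.
move=> a0; elim: n => [|n IH].
  by rewrite /degenerate_falling !big_ord0 mulr1.
by rewrite !degenerate_fallingS IH exprS; field.
Qed.

Lemma falling_natr (R : realType) (k j : nat) :
  falling (k%:R : R) j = (k ^_ j)%:R.
Proof.
elim: j => [|j IH]; first by rewrite /falling big_ord0 ffactn0.
rewrite /falling big_ord_recr/= -/(falling _ _) IH ffactnSr natrM.
by have [jk|kj] := leqP j k; [rewrite natrB|rewrite ffact_small// !mul0r].
Qed.

(** * Factorial moments of the Poisson weights, as series *)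

Lemma poisson_pmf_sum (R : realType) (r : R) : 0 < r ->
  (\sum_(k <oo) (poisson_pmf r k)%:E = 1)%E.
Proof.
move=> r0; have := probability_setT (poisson_prob r 0).
rewrite /= /poisson_prob r0 -nneseries_esumT// => k.
by rewrite lee_fin poisson_pmf_ge0.
Qed.

(** The terms with [k < j] vanish. After a shift by [j], the identity [(k + j)! = (k + j)^_j * k!]
    cancels the falling factorial and leaves [r ^+ j] times the total mass 1. *)
Lemma poisson_factorial_moment (R : realType) (r : R) (j : nat) : 0 < r ->
  (\sum_(k <oo) ((falling k%:R j)%:E * (poisson_pmf r k)%:E) = (r ^+ j)%:E)%E.
Proof.
move=> r0.
have term_ge0 k : (0 <= (falling k%:R j)%:E * (poisson_pmf r k)%:E)%E.
  by rewrite -EFinM lee_fin falling_natr mulr_ge0// poisson_pmf_ge0.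
rewrite (nneseries_split 0 j)// add0n big_nat big1 ?add0e; last first.
  by move=> k /andP[_ kj]; rewrite falling_natr ffact_small// mul0e.
rewrite -nneseries_addn//.
have shift k : ((falling (k + j)%:R j)%:E * (poisson_pmf r (k + j)%N)%:E =
    (r ^+ j)%:E * (poisson_pmf r k)%:E)%E.
  rewrite -!EFinM /poisson_pmf r0 falling_natr; congr EFin.
  have -> : ((k + j)`! = (k + j) ^_ j * k`!)%N.
    by rewrite -{3}(addnK j k) ffact_fact// leq_addl.
  have ? : ((k + j) ^_ j)%:R != 0 :> R.
    by rewrite pnatr_eq0 -lt0n ffact_gt0 leq_addl.
  have ? : k`!%:R != 0 :> R by rewrite pnatr_eq0 -lt0n fact_gt0.
  by rewrite natrM exprD; field; apply/andP.
under eq_eseriesr do rewrite shift.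
rewrite nneseriesZl => [|k _]; last by rewrite lee_fin poisson_pmf_ge0.
by rewrite poisson_pmf_sum// mule1.
Qed.

Lemma measurable_falling (R : realType) (j : nat) :
  measurable_fun [set: R] (fun x => falling x j).
Proof.
elim: j => [|j IH].
  by rewrite /falling; under eq_fun do rewrite big_ord0; exact: measurable_cst.
rewrite /falling; under eq_fun do rewrite big_ord_recr/=.
by apply: measurable_funM => //; exact: measurable_funB.
Qed.

(** * From series to expectations of a real Poisson variable *)

Section poisson_expectation.
Context (d : measure_display) (T : measurableType d) (R : realType)
  (P : probability T R) (X : {RV P >-> R}) (r : R).
Hypothesis hX : is_poisson X r.

(** [X] is real-valued and only its point masses at the naturals are given. These disjoint events
    have masses summing to 1, so integrals may be restricted to their union. *)
Let fiber (k : nat) := X @^-1` [set k%:R].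

Let measurable_fiber k : measurable (fiber k).
Proof. by rewrite /fiber -[_ @^-1` _]setTI; exact: measurable_funP. Qed.

Let trivIset_fiber : trivIset setT fiber.
Proof.
apply/trivIsetP => i j _ _ ij; rewrite -subset0 /fiber => w /= [-> /eqP].
by rewrite eqr_nat (negbTE ij).
Qed.

Let measurable_fibers : measurable (\bigcup_k fiber k).
Proof. exact: bigcup_measurable. Qed.

Let fibers_null : P (~` \bigcup_k fiber k) = 0%E.
Proof.
have [r0 PX] := hX.
rewrite probability_setC// measure_semi_bigcup//.
rewrite (eq_eseriesr (fun k _ => PX k : P (fiber k) = _)).
by rewrite poisson_pmf_sum// subee.
Qed.

Let measurable_fallingX j D :
  measurable_fun D (fun w => (falling (X w) j)%:E).
Proof.
apply: measurable_funTS; apply/measurable_EFinP.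
by apply: (measurableT_comp (@measurable_falling R j)).
Qed.

Let fallingX_ge0 j w : (\bigcup_k fiber k) w -> (0 <= (falling (X w) j)%:E)%E.
Proof. by move=> [k _ /= ->]; rewrite lee_fin falling_natr. Qed.

(** The integrand is constant on each fiber and nonnegative on their union, so countable additivity
    yields the factorial moment series. *)
Let integral_falling_fibers j :
  (\int[P]_(w in \bigcup_k fiber k) (falling (X w) j)%:E = (r ^+ j)%:E)%E.
Proof.
have [r0 PX] := hX.
rewrite ge0_integral_bigcup//; last exact: fallingX_ge0.
rewrite -poisson_factorial_moment//; apply: eq_eseriesr => k _.
rewrite -PX -/(fiber k) -integral_cst//; apply: eq_integral => w.
by rewrite inE /fiber/= => ->.
Qed.

(** [falling (X w) j] can be negative when [X w] is not a natural number, but this happens only on a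
    null set; elsewhere it equals its absolute value, whose integral is finite. *)
Lemma integrable_falling_poisson j :
  P.-integrable setT (fun w => (falling (X w) j)%:E).
Proof.
apply/(negligible_integrable (N := ~` \bigcup_k fiber k)) => //.
  exact: measurableC.
rewrite setTD setCK; apply/integrableP; split => //.
under eq_integral => w.
  rewrite inE => wA; rewrite gee0_abs ?fallingX_ge0//; over.
by rewrite integral_falling_fibers ltry.
Qed.

Lemma integral_falling_poisson j :
  (\int[P]_w (falling (X w) j)%:E = (r ^+ j)%:E)%E.
Proof.
rewrite (negligible_integral (N := ~` \bigcup_k fiber k))//.
- by rewrite setTD setCK integral_falling_fibers.
- exact: measurableC.
- exact: integrable_falling_poisson.
Qed.

Lemma expectation_falling_combination_poisson (n : nat) (c : nat -> R) :
  ('E_P[fun w : T => (\sum_(0 <= j < n) falling (X w) j * c j)%R])%E =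
  (\sum_(0 <= j < n) r ^+ j * c j)%:E.
Proof.
rewrite unlock -sumEFin.
transitivity (\int[P]_w
    (\sum_(0 <= j < n) (falling (X w) j)%:E * (c j)%:E))%E.
  by apply: eq_integral => w _; rewrite -sumEFin.
rewrite integral_sum// => [|j]; last first.
  by apply: integrableZr => //; exact: integrable_falling_poisson.
apply: eq_bigr => j _.
rewrite integralZr//; last exact: integrable_falling_poisson.
by rewrite integral_falling_poisson.
Qed.

End poisson_expectation.

(** Serves twice in the theorem, with [a j] a power of the Poisson rate and with [a j] the falling
    factorial of [X w], so that both sides get the same coefficients. *)
Lemma exchange_triangular_sum (R : comNzRingType) (b a : nat -> R)
    (s : nat -> nat -> R) (n : nat) :
  \sum_(0 <= k < n) b k * \sum_(j < k.+1) s k j * a j =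
  \sum_(0 <= j < n) a j * \sum_(j <= k < n) b k * s k j.
Proof.
transitivity (\sum_(0 <= k < n) \sum_(0 <= j < n | (j <= k)%N)
    b k * (s k j * a j)).
  apply: eq_big_nat => k /andP[_ kn].
  rewrite -(big_mkord xpredT (fun j => s k j * a j)) mulr_sumr.
  by rewrite (big_nat_widen _ _ n).
rewrite (exchange_big_dep_nat xpredT)//=; apply: eq_bigr => j _.
rewrite mulr_sumr [RHS](big_nat_widenl _ 0)//=.
by apply: eq_bigr => k _; rewrite mulrA mulrC.
Qed.

Theorem theorem2 (R : realType) (d : measure_display) (T : measurableType d)
    (P : probability T R) (m : nat) (alpha lambda : R) (X : {RV P >-> R})
    (hm : (0 < m)%N) (halpha : 0 < alpha) (hlambda : lambda != 0)
    (hX : is_poisson X (alpha / m%:R)) (n : nat) :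
  ('E_P[fun w : T => degenerate_falling lambda (m%:R * X w + 1) n])%E =
    (\sum_(0 <= k < n.+1)
       'C(n, k)%:R * degenerate_falling lambda 1 (n - k) * m%:R ^+ k *
       degenerate_bell (lambda / m%:R) k (alpha / m%:R))%:E
  /\
  \sum_(0 <= k < n.+1)
     'C(n, k)%:R * degenerate_falling lambda 1 (n - k) * m%:R ^+ k *
     degenerate_bell (lambda / m%:R) k (alpha / m%:R) =
  \sum_(0 <= j < n.+1)
     alpha ^+ j *
     \sum_(j <= k < n.+1)
        'C(n, k)%:R * degenerate_falling lambda 1 (n - k) * m%:R ^+ (k - j) *
        degenerate_stirling2 (lambda / m%:R) k j.
Proof.
have m0 : m%:R != 0 :> R by rewrite pnatr_eq0 -lt0n.
set b := fun k => 'C(n, k)%:R * degenerate_falling lambda 1 (n - k) * m%:R ^+ k.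
set s := degenerate_stirling2 (lambda / m%:R).
pose c j := \sum_(j <= k < n.+1) b k * s k j.
have bellE : \sum_(0 <= k < n.+1)
    b k * degenerate_bell (lambda / m%:R) k (alpha / m%:R) =
    \sum_(0 <= j < n.+1) (alpha / m%:R) ^+ j * c j.
  by rewrite -exchange_triangular_sum.
split; rewrite bellE; last first.
  apply: eq_big_nat => j _; rewrite expr_div_n -mulrA; congr (_ * _).
  rewrite /c mulr_sumr; apply: eq_big_nat => k /andP[jk _].
  (* Writing [k = j + (k - j)] splits off the factor [m ^ j] that cancels the denominator of
     [(alpha / m) ^ j]. *)
  rewrite /b -(subnKC jk) exprD addKn; field.
  by rewrite expf_neq0.
rewrite -(expectation_falling_combination_poisson hX).
congr ('E_P[_])%E; apply/funext => w.
(* Pointwise in [w], it remains to match the Vandermonde expansion term by term, each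
   [degenerate_falling] of [m * X w] being rescaled and expanded by Stirling numbers. *)
rewrite -exchange_triangular_sum degenerate_fallingD; apply: eq_bigr => k _.
rewrite degenerate_fallingM// mulrA; congr (_ * _).
by have [-> _] := degenerate_stirling2P (lambda / m%:R) k.
Qed.
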